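(* Consider a delay-free, acyclic multisource multicast network with associated polynomial $P=\prod_{t\in T}|M_t|$ considered over $\mathbf{F}_q$. Let $\tilde P$ be obtained from $P$ by plugging in fixed values in $\mathbf{F}_q$ for the variables $a_{i,j}$, $(i,j)\in K$, and for the variables $f_{i,j}$, $(i,j)\in J$, leaving the remaining $\mu$ variables among the $a_{i,j}$ and $f_{i,j}$ flexible. Assume that there exists a solution over $\mathbf{F}_q$ to the network connection problem with these same values for the fixed coefficients. Denote by $X_1,\dots,X_\mu$ the flexible variables, which are chosen at random, and let $\widehat P$ be the remainder of $\tilde P$ modulo $(X_1^q-X_1,\dots,X_\mu^q-X_\mu)$. (If $q>|T|$ then $\widehat P=\tilde P$.) Consider $\widehat P$ as a polynomial in $X_1,\dots,X_\mu$ (with coefficients that are polynomials in the variables $b_{t,i,j}$ over $\mathbf{F}_q$), let $\prec$ be any fixed monomial ordering on the monomials in $X_1,\dots,X_\mu$, and write $X_1^{j_1}\cdots X_\mu^{j_\mu}$ for the leading monomial of $\widehat P$ with respect to $\prec$. Then the success probability is at least $$q^{-\mu}\prod_{v=1}^{\mu}(q-j_v).$$ Consequently, the success probability is in particular at least $$q^{-\mu}\min\Big\{\prod_{i=1}^{\mu}(q-s_i)\ \Big|\ X_1^{s_1}\cdots X_\mu^{s_\mu}\text{ is a monomial in the support of }\widehat P\Big\}.$$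
   Context: Network model. $G=(V,E)$ is a finite directed acyclic graph, possibly with parallel edges; $S\subseteq V$ is the set of sources and $T\subseteq V$ the set of sinks. The sources together generate $h$ symbols $X(1),\dots,X(h)\in\mathbf{F}_q$ per unit time, each symbol belonging to one source. Edges are identified with $1,\dots,|E|$; for an edge $j=(u,v)$, $\mathrm{tail}(j)=u$ and $\mathrm{head}(j)=v$. Matrices. $F=(f_{i,j})$ is the $|E|\times|E|$ matrix in which $f_{i,j}$ is a variable if $\mathrm{head}(i)=\mathrm{tail}(j)$ and $f_{i,j}=0$ otherwise. $A=(a_{i,j})$ is the $h\times|E|$ matrix in which $a_{i,j}$ is a variable if edge $j$ is an outgoing edge of the source sending the $i$-th symbol, and $a_{i,j}=0$ otherwise. For each $t\in T$, $B_t=(b_{t,i,j})$ is the $h\times|E|$ matrix in which $b_{t,i,j}$ is a variable if $\mathrm{head}(j)=t$ and $b_{t,i,j}=0$ otherwise. All these variables are distinct. The Edmonds matrix is $M_t=\begin{pmatrix}A&0\\ I-F&B_t^T\end{pmatrix}$, and $|M_t|$ denotes its determinant. Coding. Given values in $\mathbf{F}_q$ of all variables, edge $j$ carries $Y(j)=\sum_{i=1}^h a_{i,j}X(i)+\sum_{i:\mathrm{head}(i)=\mathrm{tail}(j)}f_{i,j}Y(i)$, and sink $t$ records $(b^{(t)}_1,\dots,b^{(t)}_h)$ with $b^{(t)}_i=\sum_{j:\mathrm{head}(j)=t}b_{t,i,j}Y(j)$. A solution to the network connection problem (over $\mathbf{F}_q$) is an assignment of values in $\mathbf{F}_q$ to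 all the variables $a_{i,j},f_{i,j},b_{t,i,j}$ such that every sink $t\in T$ can recover $(X(1),\dots,X(h))$ from $(b^{(t)}_1,\dots,b^{(t)}_h)$, whatever the symbols are. It is known that an assignment is a solution if and only if $P$ evaluates to a nonzero element of $\mathbf{F}_q$ at it. Random linear network coding. $K\subseteq\{1,\dots,h\}\times\{1,\dots,|E|\}$ and $J\subseteq\{1,\dots,|E|\}\times\{1,\dots,|E|\}$ are the index sets of coefficients $a_{i,j}$, respectively $f_{i,j}$, that are fixed in advance (they include all positions where the entry is $0$ by definition). The remaining $\mu$ coefficients $X_1,\dots,X_\mu$ among the $a_{i,j}$ and $f_{i,j}$ are chosen uniformly at random and independently from $\mathbf{F}_q$. The success probability is the probability that the resulting choice of all $a_{i,j}$, $f_{i,j}$ can be completed, by a choice of values in $\mathbf{F}_q$ for the $b_{t,i,j}$, to a solution to the network connection problem. Algebra. The remainder modulo $(X_1^q-X_1,\dots,X_\mu^q-X_\mu)$ is the polynomial obtained by repeatedly replacing a factor $X_i^q$ in any term by $X_i$ until the degree in each $X_i$ is less than $q$. A monomial ordering is a total ordering $\prec$ on monomials such that $L\prec M$ implies $LN\prec MN$ and such that every nonempty set of monomials has a smallest element. The leading monomial is the $\prec$-largest monomial in the support. *)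

(* Defs.v *)
From HB Require Import structures.
From mathcomp Require Import all_boot all_order all_algebra.
From mathcomp.multinomials Require Import mpoly.

Set Implicit Arguments.
Unset Strict Implicit.
Unset Printing Implicit Defensive.

Import Order.TTheory GRing.Theory Num.Theory.
Local Open Scope ring_scope.

(* Edges are the elements of 'I_m, so parallel edges are allowed; [origin i]  *)
(* is the source that generates the i-th symbol.                              *)
Record network (V : finType) (h m : nat) := Network {
  etail : 'I_m -> V;
  ehead : 'I_m -> V;
  sources : {set V};
  sinks : {set V};
  origin : 'I_h -> V;
  origin_source : forall i, origin i \in sources;
  acyclic : forall w : seq 'I_m, w != [::] ->
    ~~ cycle (fun i j => ehead i == etail j) w
}.

(* Names of the variables a_{i,j} and f_{i,j}, and of the b_{t,i,j}. There is *)
(* a name for every position; the positions at which the matrices of a        *)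
(* network vanish by definition have a name that does not occur in them.      *)
Definition code_var (h m : nat) : finType :=
  (('I_h * 'I_m) + ('I_m * 'I_m))%type.
Definition sink_var (V : finType) (h m : nat) : finType :=
  (V * 'I_h * 'I_m)%type.
Definition net_var (V : finType) (h m : nat) : finType :=
  (code_var h m + sink_var V h m)%type.

Definition avar {h m} (i : 'I_h) (j : 'I_m) : code_var h m := inl (i, j).
Definition fvar {h m} (i j : 'I_m) : code_var h m := inr (i, j).
Definition bvar {V : finType} {h m} (t : V) (i : 'I_h) (j : 'I_m) :
  sink_var V h m := (t, i, j).

Definition mvar (R : nzRingType) (I : finType) (x : I) : {mpoly R[#|I|]} :=
  'X_(enum_rank x).

Section Edmonds.

Variables (F : finFieldType) (V : finType) (h m : nat) (N : network V h m).

Definition net_poly := {mpoly F[#|net_var V h m|]}.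

Definition Amx : 'M[net_poly]_(h, m) :=
  \matrix_(i, j) if etail N j == origin N i
                 then mvar F (inl (avar i j) : net_var V h m) else 0.

Definition Fmx : 'M[net_poly]_m :=
  \matrix_(i, j) if ehead N i == etail N j
                 then mvar F (inl (fvar i j) : net_var V h m) else 0.

Definition Bmx (t : V) : 'M[net_poly]_(h, m) :=
  \matrix_(i, j) if ehead N j == t
                 then mvar F (inr (bvar t i j) : net_var V h m) else 0.

Definition Edmonds (t : V) : 'M[net_poly]_(h + m) :=
  castmx (erefl, addnC m h) (block_mx (Amx : 'M_(h, m)) (0 : 'M_(h, h))
                                      (1%:M - Fmx)      (Bmx t)^T).

Definition netP : net_poly := \prod_(t in sinks N) \det (Edmonds t).

End Edmonds.

Section Coding.

Variables (F : finFieldType) (V : finType) (h m : nat) (N : network V h m).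
Variables (c : code_var h m -> F) (b : sink_var V h m -> F).

(* The values assigned respect the positions that are 0 by definition.        *)
Definition well_supported : bool :=
  [&& [forall i, forall j,
         (etail N j != origin N i) ==> (c (avar i j) == 0)],
      [forall i, forall j, (ehead N i != etail N j) ==> (c (fvar i j) == 0)]
    & [forall t in sinks N, forall i, forall j,
         (ehead N j != t) ==> (b (bvar t i j) == 0)]].

(* [Y j] is the symbol carried by edge [j] when the sources generate [X]. By  *)
(* acyclicity the equations have exactly one solution [Y] for each [X].       *)
Definition carries (X : {ffun 'I_h -> F}) (Y : {ffun 'I_m -> F}) : bool :=
  [forall j, Y j == \sum_(i < h) c (avar i j) * X i
      + \sum_(i < m | ehead N i == etail N j) c (fvar i j) * Y i].

Definition received (t : V) (Y : {ffun 'I_m -> F}) : {ffun 'I_h -> F} :=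
  [ffun i => \sum_(j < m | ehead N j == t) b (bvar t i j) * Y j].

Definition can_recover (t : V) : bool :=
  [exists D : {ffun {ffun 'I_h -> F} -> {ffun 'I_h -> F}},
    [forall X, forall Y, carries X Y ==> (D (received t Y) == X)]].

Definition is_solution : bool :=
  well_supported && [forall t in sinks N, can_recover t].

End Coding.

Section Random.

Variables (h m : nat) (K : {set 'I_h * 'I_m}) (J : {set 'I_m * 'I_m}).

Definition flexible : {set code_var h m} :=
  [set x | match x with
           | inl ij => ij \notin K
           | inr ij => ij \notin J
           end].

(* The flexible variables X_1, ..., X_mu are listed by [enum_val].            *)
Definition mu : nat := #|flexible|.

Definition plug_in (S : Type) (x : 'I_mu -> S) (c0 : code_var h m -> S) :
    code_var h m -> S :=
  fun y => if [pick v : 'I_mu | enum_val v == y] is Some v then x v else c0 y.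

Variables (F : finFieldType) (V : finType) (N : network V h m).
Variable (c0 : code_var h m -> F).

Definition sink_poly := {mpoly F[#|sink_var V h m|]}.

Definition Ptilde : {mpoly sink_poly[mu]} :=
  mmap (fun a : F => (a%:MP : sink_poly)%:MP)
    (fun k : 'I_#|net_var V h m| =>
       match enum_val k with
       | inl y => plug_in (fun v => 'X_v)
                          (fun y' => ((c0 y')%:MP : sink_poly)%:MP) y
       | inr z => (mvar F (z : sink_var V h m))%:MP
       end)
    (netP F N).

Definition success (x : 'I_mu -> F) : bool :=
  [exists b : {ffun sink_var V h m -> F}, is_solution N (plug_in x c0) b].

Definition success_probability : rat :=
  \sum_(x : {ffun 'I_mu -> F} | success x) \prod_(v < mu) (#|F|%:R)^-1.

End Random.

(* Replacing a factor X^q by X; for q > 1 the exponent decreases strictly as  *)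
(* long as it is at least q, so that e steps are enough to get below q.       *)
Definition reduce_step (q e : nat) : nat :=
  if (q <= e)%N then (e - q).+1 else e.
Definition reduce_exp (q e : nat) : nat := iter e (reduce_step q) e.

(* Remainder modulo the polynomials X_v^q - X_v.                              *)
Definition reduce (R : nzRingType) (n q : nat) (p : {mpoly R[n]}) :
    {mpoly R[n]} :=
  \sum_(M <- msupp p) p@_M *: 'X_[[multinom reduce_exp q (M v) | v < n]].

(* [lt] is the strict order; monomials multiply by adding their exponents.    *)
Definition monomial_order (n : nat) (lt : rel 'X_{1..n}) : Prop :=
  [/\ irreflexive lt, transitive lt,
      (forall L M, L != M -> lt L M || lt M L),
      (forall L M N, lt L M -> lt (L + N)%MM (M + N)%MM)
    & forall A : 'X_{1..n} -> Prop, (exists M, A M) ->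
        exists2 M, A M & forall L, A L -> L != M -> lt M L].

Definition leading_monomial (R : nzRingType) (n : nat) (lt : rel 'X_{1..n})
    (p : {mpoly R[n]}) (M : 'X_{1..n}) : Prop :=
  M \in msupp p /\ forall L, L \in msupp p -> L != M -> lt L M.

Definition Phat (h m : nat) (K : {set 'I_h * 'I_m}) (J : {set 'I_m * 'I_m})
    (F : finFieldType) (V : finType) (N : network V h m)
    (c0 : code_var h m -> F) : {mpoly (sink_poly h m F V)[mu K J]} :=
  reduce #|F| (Ptilde K J N c0).


(* The minimum of [w] over the support of [p]; the initial value is itself a  *)
(* value of [w] on the support when p != 0, the only case of interest.        *)
Definition min_on_support (R : nzRingType) (n : nat) (p : {mpoly R[n]})
    (w : 'X_{1..n} -> rat) : rat :=
  \big[Num.min / w (head 0%MM (msupp p))]_(s <- msupp p) w s.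

(* Main.v *)
(* For fixed values of the coding coefficients, put G = (I - F)^-1, which      *)
(* exists because the graph is acyclic. Up to a unit, |M_t| is the            *)
(* determinant of A G B_t^T, the matrix by which sink t sees the symbols.     *)
(* When it is nonzero with B_t generic, the columns of A G at the edges       *)
(* entering t have rank h, so suitable values in F_q for B_t exist. Hence     *)
(* every point x of F_q^mu at which Phat is a nonzero polynomial in the b's   *)
(* is successful. It remains to count these points (footprint bound): if      *)
(* fewer than prod_v (q - j_v) of them existed, a nonzero combination g of    *)
(* the monomials X^L with L_v < q - j_v would vanish on all of them, so       *)
(* g * Phat would vanish on F_q^mu; but its leading monomial is reduced       *)
(* modulo the X_v^q - X_v, so g * Phat has a nonzero remainder.               *)

Require Import Defs.
From mathcomp Require Import all_boot all_order all_algebra finfield.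
From mathcomp.multinomials Require Import mpoly.

Set Implicit Arguments.
Unset Strict Implicit.
Unset Printing Implicit Defensive.

Import Order.TTheory GRing.Theory Num.Theory.
Local Open Scope ring_scope.

(** * Reduction of exponents and the footprint bound *)

(** The algebraic half turns decoding into linear algebra. Multiplication by an explicit invertible
    matrix ([det_Edmonds_eq0]) shows that sink t can decode exactly when [transfer *m (B_val b t)^T]
    is invertible ([can_recoverE]). [exists_sink_values] replaces generic sink coefficients by
    values in F_q through a rank argument, one sink at a time and for every q, which gives
    [success_of_meval]. Evaluating at the assumed solution yields [Phat_neq0].

    The counting half is [footprint_bound]. No quotient ring is formed: [mnm_weights] provides
    linear functionals that read a coefficient of the remainder off the values on F_q^n, and
    [leading_add] isolates the coefficient of the product of the two leading monomials. By
    [meval_reduce], values of [Phat] and [Ptilde] agree on these points, so the count bounds the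
    successful choices. *)

Lemma reduce_step_small (q k e : nat) :
  (e < q)%N -> iter k (reduce_step q) e = e.
Proof.
by move=> lt_eq; elim: k => //= k ->; rewrite /reduce_step leqNgt lt_eq.
Qed.

Lemma reduce_step_iter (q k e : nat) : (1 < q)%N -> (e <= k)%N ->
  (iter k (reduce_step q) e < q)%N.
Proof.
move=> q1; elim: k e => [|k IH] e.
  by rewrite leqn0 => /eqP->; apply: ltnW.
move=> ek; have [lt_eq|le_qe] := ltnP e q; first by rewrite reduce_step_small.
rewrite iterSr; apply: IH; rewrite /reduce_step le_qe -ltnS.
by apply: leq_trans ek; rewrite -{2}(subnK le_qe) -addn2 leq_add2l.
Qed.

Lemma reduce_exp_lt (q e : nat) : (1 < q)%N -> (reduce_exp q e < q)%N.
Proof. by move=> q1; apply: reduce_step_iter. Qed.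

Lemma reduce_exp_le (q e : nat) : (1 < q)%N -> (reduce_exp q e <= e)%N.
Proof.
move=> q1; rewrite /reduce_exp; elim: {1}e => //= k IH; apply: leq_trans IH.
rewrite {1}/reduce_step; case: ifP => // le_q.
by rewrite -{2}(subnK le_q) -addn1 leq_add2l ltnW.
Qed.

Lemma reduce_exp_small (q e : nat) : (e < q)%N -> reduce_exp q e = e.
Proof. exact: reduce_step_small. Qed.

Lemma expf_reduce_exp (F : finFieldType) (x : F) (e : nat) :
  x ^+ reduce_exp #|F| e = x ^+ e.
Proof.
rewrite /reduce_exp; elim: {1}e => //= k IH; rewrite -[RHS]IH.
rewrite {1}/reduce_step; case: ifP => // le_q.
by rewrite -{2}(subnK le_q) exprD expf_card exprSr.
Qed.

Definition reduce_mnm (n q : nat) (M : 'X_{1..n}) : 'X_{1..n} :=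
  [multinom reduce_exp q (M v) | v < n].

Section Footprint.

Variables (F : finFieldType) (R : idomainType) (iota : {rmorphism F -> R}).
Variable n : nat.

Local Notation q := #|F|.
Local Notation point := {ffun 'I_n -> F}.

Definition iota_point (x : point) (v : 'I_n) : R := iota (x v).

Lemma prod_reduce_mnm (x : point) (L : 'X_{1..n}) :
  \prod_v iota_point x v ^+ reduce_mnm q L v = \prod_v iota_point x v ^+ L v.
Proof.
by apply: eq_bigr => v _; rewrite mnmE -!rmorphXn expf_reduce_exp.
Qed.

Lemma meval_reduce (p : {mpoly R[n]}) (x : point) :
  (reduce q p).@[iota_point x] = p.@[iota_point x].
Proof.
rewrite /reduce raddf_sum mevalE; apply: eq_bigr => M _ /=.
by rewrite mevalZ mevalX -[in RHS]prod_reduce_mnm.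
Qed.

(** A polynomial of degree below q is determined by its values on F, so each coefficient is a linear
    functional of these values. *)
Lemma coef_weights : exists w : 'I_q -> F -> F, forall (e : 'I_q) (d : nat),
  (d < q)%N -> \sum_x w e x * x ^+ d = (e == d :> nat)%:R.
Proof.
(* The weights are the entries of the inverse of a Vandermonde matrix. *)
pose a : 'rV[F]_q := \row_j enum_val j.
have unitV : Vandermonde q a \in unitmx.
  rewrite unitmxE det_Vandermonde unitfE; apply/prodf_neq0 => i _.
  apply/prodf_neq0 => j ltij; rewrite !mxE subr_eq0.
  by apply: contraTneq ltij => /enum_val_inj->; rewrite ltnn.
exists (fun e x => invmx (Vandermonde q a) (enum_rank x) e) => e d lt_dq.
have /matrixP/(_ (Ordinal lt_dq) e) := mulmxV unitV.
rewrite !mxE => E; rewrite eq_sym -[RHS]E.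
rewrite (reindex _ (onW_bij _ (@enum_val_bij F))) /=.
by apply: eq_bigr => i _; rewrite !mxE enum_valK mulrC.
Qed.

(** Products of the one-variable weights: the sum over all points factors into one sum per variable.
    By linearity, [W] reads off the coefficient of X^M in the remainder of any polynomial. *)
Lemma mnm_weights (M : 'X_{1..n}) : (forall v, M v < q)%N ->
  exists W : point -> R, forall L : 'X_{1..n},
    \sum_x W x * \prod_v iota_point x v ^+ L v = (M == reduce_mnm q L)%:R.
Proof.
move=> ltM; have [w wE] := coef_weights.
exists (fun x => \prod_v iota (w (Ordinal (ltM v)) (x v))) => L.
under eq_bigr => x _ do rewrite -prod_reduce_mnm -big_split /=.
rewrite -(bigA_distr_bigA (fun v y => iota (w (Ordinal (ltM v)) y) *
   iota y ^+ reduce_mnm q L v)).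
under eq_bigr => v _.
  under eq_bigr => y _ do rewrite -rmorphXn -rmorphM.
  rewrite -rmorph_sum wE ?mnmE ?reduce_exp_lt ?finNzRing_gt1 //= rmorph_nat.
  over.
have [->|neqM] := eqVneq; first by rewrite big1 // => v _; rewrite mnmE eqxx.
have [v neqv] : exists v, M v != reduce_mnm q L v.
  apply/existsP; apply: contraNT neqM; rewrite negb_exists => /forallP eqv.
  by apply/eqP/mnmP => v; apply/eqP; rewrite -[_ == _]negbK.
by move: neqv; rewrite mnmE (bigD1 v) //= => /negPf->; rewrite mul0r.
Qed.

Variable lt : rel 'X_{1..n}.
Hypotheses (lt_irr : irreflexive lt) (lt_trans : transitive lt).
Hypothesis lt_total : forall L M, L != M -> lt L M || lt M L.
Hypothesis lt_add : forall L M N, lt L M -> lt (L + N)%MM (M + N)%MM.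
Hypothesis lt_0 : forall M, M != 0%MM -> lt 0%MM M.

Lemma leading_monomial_exists (p : {mpoly R[n]}) :
  p != 0 -> exists M, leading_monomial lt p M.
Proof.
rewrite -msupp_eq0 /leading_monomial; elim: (msupp p) => // M s IH _.
have [->|s0] := eqVneq s [::].
  by exists M; split=> [|L]; rewrite inE // => ->.
have [L [Ls Lmax]] := IH s0; have [ltLM|leML] := boolP (lt L M).
  exists M; split=> [|L']; rewrite inE ?eqxx // => /predU1P[->|].
    by rewrite eqxx.
  move=> L's _; have [->//|neqL] := eqVneq L' L.
  exact: lt_trans (Lmax _ L's neqL) ltLM.
exists L; split=> [|L']; first by rewrite inE Ls orbT.
rewrite inE => /predU1P[->|]; last exact: Lmax.
by move/lt_total; rewrite (negPf leML) orbF.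
Qed.

(** The reduced monomial divides the original one, and a nontrivial cofactor is above 1 in the
    order. *)
Lemma reduce_mnm_le (L : 'X_{1..n}) :
  reduce_mnm q L = L \/ lt (reduce_mnm q L) L.
Proof.
have [->|neqL] := eqVneq (reduce_mnm q L) L; [by left | right].
pose D := [multinom (L v - reduce_mnm q L v)%N | v < n].
have LE : L = (D + reduce_mnm q L)%MM.
  apply/mnmP => v; rewrite mnmDE !mnmE subnK //.
  by rewrite reduce_exp_le ?finNzRing_gt1.
have D0 : D != 0%MM by apply: contraNneq neqL => D0; rewrite {2}LE D0 add0m.
by rewrite {2}LE -[X in lt X _]add0m; apply/lt_add/lt_0.
Qed.

(** Any other pair has a product strictly below the product of the leading monomials, and reduction
    can only lower it further. Hence no cancellation occurs at that monomial in the remainder of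
    [p1 * p2]. *)
Lemma leading_add (p1 p2 : {mpoly R[n]}) (M1 M2 L1 L2 : 'X_{1..n}) :
  leading_monomial lt p1 M1 -> leading_monomial lt p2 M2 ->
  L1 \in msupp p1 -> L2 \in msupp p2 ->
  ((M1 + M2)%MM == reduce_mnm q (L1 + L2)) ->
  L1 = M1 /\ L2 = M2.
Proof.
move=> [_ max1] [_ max2] L1p L2p /eqP E.
have nlt : ~ lt (L1 + L2)%MM (M1 + M2)%MM.
  move=> ltL; move: (reduce_mnm_le (L1 + L2)%MM); rewrite -E.
  case=> [EM|/(lt_trans ltL)]; last by rewrite lt_irr.
  by rewrite EM lt_irr in ltL.
have [EL1|neq1] := eqVneq L1 M1; have [EL2|neq2] := eqVneq L2 M2;
  rewrite //; case: nlt.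
- by rewrite EL1 ![(M1 + _)%MM]addmC; apply/lt_add/max2.
- by rewrite EL2; apply/lt_add/max1.
apply: lt_trans (lt_add _ (max1 _ L1p neq1)) _.
by rewrite ![(M1 + _)%MM]addmC; apply/lt_add/max2.
Qed.

Lemma footprint_bound (p : {mpoly R[n]}) (M : 'X_{1..n}) :
  leading_monomial lt p M -> (forall v, M v < q)%N ->
  (\prod_v (q - M v) <= #|[set x : point | p.@[iota_point x] != 0%R]|)%N.
Proof.
move=> leadM ltM; set S := [set x | _].
(* These are exactly the exponent vectors L for which L + M stays below q in every variable. *)
pose box := family (fun v => [pred e : 'I_q | e < q - M v]%N).
have <- : #|box| = (\prod_v (q - M v))%N.
  rewrite card_family foldrE big_image; apply: eq_bigr => v _.
  rewrite -sum1_card (big_ord_narrow (leq_subr _ _)).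
  by rewrite sum1_card card_ord.
rewrite leqNgt; apply/negP => ltS.
pose mon (i : 'I_#|box|) := [multinom (enum_val i v : nat) | v < n].
have mon_inj : injective mon.
  move=> i j /mnmP eqm; apply/enum_val_inj/ffunP => v; apply/val_inj.
  by have := eqm v; rewrite !mnmE.
have mon_lt i v : (mon i v < q - M v)%N.
  by rewrite mnmE; have /familyP/(_ v) := enum_valP i; rewrite inE.
pose pt (j : nat) : point := nth [ffun=> 0] (enum S) j.
(* Columns beyond #|S| are padded with 0 to get a square singular matrix. *)
pose A : 'M[R]_#|box| := \matrix_(i, j)
  if (j < #|S|)%N then \prod_v iota_point (pt j) v ^+ mon i v else 0.
have /eqP/det0P[u u0 uA] : \det A = 0.
  (* Column [#|S|] exists because [#|S| < #|box|], and it is the first padding column. *)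
  rewrite -det_tr; apply/eqP/det0P; exists (delta_mx 0 (Ordinal ltS)).
    by apply/eqP => /rowP/(_ (Ordinal ltS))/eqP; rewrite !mxE !eqxx oner_eq0.
  by rewrite -rowE; apply/rowP => i; rewrite !mxE ltnn.
pose g : {mpoly R[n]} := \sum_i u 0 i *: 'X_[mon i].
have g0 : g != 0.
  apply: contraNneq u0 => g0; apply/eqP/rowP => i; rewrite mxE.
  rewrite -(mcoeff0 R (mon i)) -g0 raddf_sum (bigD1 i) //= mcoeffZ mcoeffX eqxx.
  rewrite mulr1 big1 ?addr0 // => j neqj.
  by rewrite mcoeffZ mcoeffX (inj_eq mon_inj) (negPf neqj) mulr0.
have gS x : x \in S -> g.@[iota_point x] = 0.
  move=> xS; have ltxS : (index x (enum S) < #|S|)%N.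
    by rewrite cardE index_mem mem_enum.
  have ltx := ltn_trans ltxS ltS.
  have /rowP/(_ (Ordinal ltx)) := uA; rewrite !mxE => E; rewrite -[RHS]E.
  rewrite /g raddf_sum; apply: eq_bigr => i _ /=.
  by rewrite mevalZ mevalX mxE /= ltxS /pt nth_index ?mem_enum.
have gp x : g.@[iota_point x] * p.@[iota_point x] = 0.
  have [/gS->|] := boolP (x \in S); first by rewrite mul0r.
  by rewrite inE negbK => /eqP->; rewrite mulr0.
have [L leadL] := leading_monomial_exists g0.
have ltML v : ((L + M)%MM v < q)%N.
  have /msupp_sum_le/flattenP[_ /mapP[i _ ->] /msuppZ_le] := proj1 leadL.
  rewrite msuppX inE => /eqP->; rewrite mnmDE addnC.
  by rewrite -ltn_subRL mon_lt.
have [W WE] := mnm_weights ltML.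
(* This sum is the coefficient of X^(L + M) in the remainder of [g * p]. It vanishes pointwise,
   while its expansion over pairs of monomials leaves only [g@_L * p@_M], which is nonzero. *)
have : \sum_x W x * (g.@[iota_point x] * p.@[iota_point x]) = 0.
  by rewrite big1 // => x _; rewrite gp mulr0.
have -> : \sum_x W x * (g.@[iota_point x] * p.@[iota_point x]) =
    \sum_(L1 <- msupp g) \sum_(L2 <- msupp p) g@_L1 * p@_L2 *
      ((L + M)%MM == reduce_mnm q (L1 + L2))%:R.
  under eq_bigr => x _ do rewrite 2!mevalE big_distrl mulr_sumr /=.
  rewrite exchange_big /=; apply: eq_bigr => L1 _.
  under eq_bigr => x _ do rewrite 2!mulr_sumr.
  rewrite exchange_big /=; apply: eq_bigr => L2 _.
  rewrite -WE mulr_sumr; apply: eq_bigr => x _.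
  under [in RHS]eq_bigr => v _ do rewrite mnmDE exprD.
  by rewrite big_split /= mulrACA [LHS]mulrCA.
rewrite (bigD1_seq L) ?msupp_uniq ?(proj1 leadL) //=.
rewrite (bigD1_seq M) ?msupp_uniq ?(proj1 leadM) //=.
rewrite !big1_seq ?addr0 => [|L1|L2].
- have -> : reduce_mnm q (L + M) = (L + M)%MM.
    by apply/mnmP => v; rewrite mnmE reduce_exp_small.
  move/eqP; rewrite eqxx mulr1 mulf_eq0 !mcoeff_eq0.
  by rewrite (proj1 leadL) (proj1 leadM).
- case/andP => neq1 L1g; rewrite big1_seq // => L2 /andP[_ L2p].
  case: (boolP (_ == _)) => [|_]; last by rewrite mulr0.
  by case/(leading_add leadL leadM L1g L2p) => E; rewrite E eqxx in neq1.
case/andP => neq2 L2p; case: (boolP (_ == _)) => [|_]; last by rewrite mulr0.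
case/(leading_add leadL leadM (proj1 leadL) L2p) => _ E.
by rewrite E eqxx in neq2.
Qed.

End Footprint.

(** * Edmonds matrices and transfer matrices *)

Section EdmondsDeterminant.

Variables (R : idomainType) (h m : nat).
Variables (A : 'M[R]_(h, m)) (C G : 'M[R]_m) (D : 'M[R]_(m, h)).

Lemma mulmx_cast (n1 n2 p q : nat) (e : n1 = n2) (X : 'M[R]_(p, n1))
    (Y : 'M[R]_(n1, q)) :
  castmx (erefl, e) X *m castmx (e, erefl) Y = X *m Y.
Proof. by case: _ / e; rewrite !castmx_id. Qed.

(** Right multiplication by the invertible matrix [Q] makes the Edmonds matrix block upper
    triangular, with diagonal blocks [A *m G *m D] and 1. Comparing only vanishing avoids computing
    the sign of the determinant. *)
Lemma det_Edmonds_eq0 : C *m G = 1%:M ->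
  (\det (castmx (erefl, addnC m h) (block_mx A 0 C D)) == 0) =
  (\det (A *m G *m D) == 0).
Proof.
move=> CG; pose Q : 'M[R]_(h + m) :=
  castmx (addnC m h, erefl) (block_mx (G *m D) G (- 1%:M) 0).
have detQ : \det Q != 0.
  (* This left factor is a left inverse of [Q]. *)
  have : \det (castmx (erefl, addnC m h) (block_mx 0 (- 1%:M) C D) *m Q) != 0.
    rewrite mulmx_cast mulmx_block !mul0mx !mulmx0 !mulNmx !mulmxN !mul1mx.
    rewrite mulmx1 mulmxA CG mul1mx opprK !add0r addr0 subrr.
    by rewrite -scalar_mx_block det1 oner_eq0.
  by rewrite det_mulmx mulf_eq0 negb_or => /andP[].
have <- : \det (castmx (erefl, addnC m h) (block_mx A 0 C D) *m Q) =
    \det (A *m G *m D).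
  rewrite mulmx_cast mulmx_block !mul0mx !mulmx0 !mulmxN mulmx1 !addr0.
  by rewrite !mulmxA CG mul1mx subrr det_ublock det1 mulr1.
by rewrite det_mulmx mulf_eq0 (negPf detQ) orbF.
Qed.

End EdmondsDeterminant.

Section NetworkMatrices.

Variables (V : finType) (h m : nat) (N : network V h m).

Section Definitions.

Variable R : comNzRingType.
Variables (c : code_var h m -> R) (b : sink_var V h m -> R).

(** With entries in an arbitrary commutative ring, the same matrices serve for generic variables,
    for the partially plugged-in network and for values in F_q; ring morphisms pass between these
    cases. *)
Definition A_val : 'M[R]_(h, m) :=
  \matrix_(i, j) if etail N j == origin N i then c (avar i j) else 0.

Definition F_val : 'M[R]_m :=
  \matrix_(i, j) if ehead N i == etail N j then c (fvar i j) else 0.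

Definition B_val (t : V) : 'M[R]_(h, m) :=
  \matrix_(i, j) if ehead N j == t then b (bvar t i j) else 0.

Definition Edmonds_val (t : V) : 'M[R]_(h + m) :=
  castmx (erefl, addnC m h)
    (block_mx A_val (0 : 'M_(h, h)) (1%:M - F_val) (B_val t)^T).

End Definitions.

Lemma eq_Edmonds_val (R : comNzRingType) (c c' : code_var h m -> R)
    (b b' : sink_var V h m -> R) (t : V) :
  c =1 c' -> b =1 b' -> Edmonds_val c b t = Edmonds_val c' b' t.
Proof.
move=> eqc eqb; congr (castmx _ (block_mx _ _ (_ - _) _^T));
  by apply/matrixP => i j; rewrite !mxE ?eqc ?eqb.
Qed.

Lemma rmorph_det_Edmonds_val (R S : comNzRingType) (phi : {rmorphism R -> S})
    (c : code_var h m -> R) (b : sink_var V h m -> R) (t : V) :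
  phi (\det (Edmonds_val c b t)) =
  \det (Edmonds_val (fun y => phi (c y)) (fun z => phi (b z)) t).
Proof.
rewrite -det_map_mx map_castmx.
congr (\det (castmx _ _)); rewrite map_block_mx map_mx0 map_mxB map_mx1.
rewrite -map_trmx; congr (block_mx _ _ (_ - _) _^T);
  by apply/matrixP => i j; rewrite !mxE; case: ifP => // _; apply: rmorph0.
Qed.

Lemma netPE (F : finFieldType) : netP F N = \prod_(t in sinks N)
  \det (Edmonds_val (fun y => mvar F (inl y : net_var V h m))
                    (fun z => mvar F (inr z : net_var V h m)) t).
Proof. by []. Qed.

Local Notation follows := (fun i j : 'I_m => ehead N i == etail N j).

(* [ancestors] increases along the edges, so it serves as induction measure. *)
Definition ancestors (j : 'I_m) : nat := #|[pred k | connect follows k j]|.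

Lemma ancestors_lt (i j : 'I_m) :
  ehead N i == etail N j -> (ancestors i < ancestors j)%N.
Proof.
move=> ij; apply/proper_card/properP; split.
  apply/subsetP => k; rewrite !inE => ki.
  exact: connect_trans ki (@connect1 _ follows i j ij).
exists j; rewrite !inE ?connect0 //; apply/negP => /connectP[p jp ip].
have /negP := @acyclic _ _ _ N (j :: p) isT; apply.
by rewrite /= rcons_path jp -ip.
Qed.

Section Field.

Variables (F : finFieldType) (c : code_var h m -> F).

(** If u = uF, each entry of u is a combination of entries at edges with strictly fewer ancestors,
    so u vanishes by induction. *)
Lemma sub1F_unit : 1%:M - F_val c \in unitmx.
Proof.
rewrite -row_free_unit -kermx_eq0 -submx0; apply/rV_subP => u.
move=> /sub_kermxP/eqP; rewrite mulmxBr mulmx1 subr_eq0 => /eqP uF.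
suff -> : u = 0 by rewrite sub0mx.
apply/rowP => j; rewrite mxE; have [k] := ubnP (ancestors j).
elim: k j => // k IH j; rewrite ltnS => le_jk.
rewrite uF mxE big1 // => i _; rewrite mxE.
case: ifP => [ij|_]; last by rewrite mulr0.
by rewrite IH ?mul0r // (leq_trans (ancestors_lt ij)).
Qed.

Definition transfer : 'M[F]_(h, m) := A_val c *m invmx (1%:M - F_val c).

Lemma det_Edmonds_val_eq0 (b : sink_var V h m -> F) (t : V) :
  (\det (Edmonds_val c b t) == 0) = (\det (transfer *m (B_val b t)^T) == 0).
Proof. by rewrite (det_Edmonds_eq0 _ _ (mulmxV sub1F_unit)). Qed.

Let row_of k (X : {ffun 'I_k -> F}) : 'rV[F]_k := \row_i X i.
Let of_row k (u : 'rV[F]_k) : {ffun 'I_k -> F} := [ffun i => u 0 i].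

Let row_ofK k (X : {ffun 'I_k -> F}) : of_row (row_of X) = X.
Proof. by apply/ffunP => i; rewrite !ffunE mxE. Qed.

Let of_rowK k (u : 'rV[F]_k) : row_of (of_row u) = u.
Proof. by apply/rowP => i; rewrite mxE ffunE. Qed.

Lemma row_received (b : sink_var V h m -> F) (t : V) (Y : {ffun 'I_m -> F}) :
  row_of (received N b t Y) = row_of Y *m (B_val b t)^T.
Proof.
apply/rowP => i; rewrite !mxE ffunE big_mkcond; apply: eq_bigr => j _.
by rewrite !mxE mulrC; case: ifP; rewrite ?mulr0.
Qed.

(** The edge equations read Y = XA + YF, solved for Y by inverting I - F. The support condition is
    there because [carries] sums over all symbols, whereas [A_val] masks the positions that are 0 by
    definition. *)
Lemma carriesE (X : {ffun 'I_h -> F}) (Y : {ffun 'I_m -> F}) :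
  (forall i j, etail N j != origin N i -> c (avar i j) = 0) ->
  carries N c X Y = (row_of Y == row_of X *m transfer).
Proof.
move=> c0; rewrite mulmxA -(can2_eq (mulmxK sub1F_unit) (mulmxKV sub1F_unit)).
rewrite mulmxBr mulmx1 subr_eq; apply/forallP/eqP => [Yj|/rowP Yj j].
  apply/rowP => j; rewrite mxE (eqP (Yj j)) !mxE; congr (_ + _).
    apply: eq_bigr => i _; rewrite !mxE mulrC; case: ifPn => // /c0->.
    by rewrite mulr0.
  rewrite big_mkcond; apply: eq_bigr => i _; rewrite !mxE mulrC.
  by case: ifP; rewrite ?mulr0.
have := Yj j; rewrite !mxE => ->; apply/eqP; congr (_ + _).
  apply: eq_bigr => i _; rewrite !mxE mulrC; case: ifPn => // /c0->.
  by rewrite mul0r.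
rewrite [RHS]big_mkcond; apply: eq_bigr => i _; rewrite !mxE mulrC.
by case: ifP; rewrite ?mul0r.
Qed.

Lemma can_recoverE (b : sink_var V h m -> F) (t : V) :
  (forall i j, etail N j != origin N i -> c (avar i j) = 0) ->
  can_recover N c b t = (\det (Edmonds_val c b t) != 0).
Proof.
move=> c0; rewrite det_Edmonds_val_eq0 -unitfE -unitmxE.
apply/existsP/idP => [[D /forallP Drec]|unitT].
  rewrite -row_free_unit -kermx_eq0 -submx0; apply/rV_subP => u /sub_kermxP uT.
  (* Every message in the left kernel is received as 0, so the decoder cannot tell it from the zero
     message. *)
  have rec v : v *m (transfer *m (B_val b t)^T) = 0 -> of_row v = D [ffun=> 0].
    move=> vT.
    have /forallP/(_ (of_row (v *m transfer)))/implyP := Drec (of_row v).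
    rewrite carriesE // !of_rowK eqxx => /(_ isT)/eqP <-; congr (D _).
    apply: (can_inj (@row_ofK h)).
    rewrite row_received of_rowK -mulmxA vT.
    by apply/rowP => i; rewrite !mxE ffunE.
  by rewrite -(of_rowK u) (rec u uT) -(rec 0) ?mul0mx // of_rowK submx0.
exists [ffun Z => of_row (row_of Z *m invmx (transfer *m (B_val b t)^T))].
apply/forallP => X; apply/forallP => Y; apply/implyP.
rewrite carriesE // => /eqP XY.
by rewrite ffunE row_received XY -(mulmxA _ transfer) mulmxK // row_ofK.
Qed.

(** Nonvanishing over an extension [R] forces the columns of [transfer] at the edges entering t to
    have rank h, already over F. A right inverse over F then supplies the sink values, independently
    for each t since the b's of different sinks are distinct variables. *)
Lemma exists_sink_values (R : idomainType) (iota : {rmorphism F -> R})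
    (z : sink_var V h m -> R) :
  {in sinks N, forall t, \det (Edmonds_val (fun y => iota (c y)) z t) != 0} ->
  exists b : {ffun sink_var V h m -> F}, {in sinks N, forall t,
    (forall i j, ehead N j != t -> b (bvar t i j) = 0) /\
    \det (Edmonds_val c b t) != 0}.
Proof.
move=> detz; pose into t : 'M[F]_m := diag_mx (\row_j (ehead N j == t)%:R).
(* The values at sink t form a right inverse of the part of [transfer] that    *)
(* belongs to the edges entering t.                                           *)
exists [ffun y : sink_var V h m => if ehead N y.2 == y.1.1
  then pinvmx (transfer *m into y.1.1) y.2 y.1.2 else 0] => t tN; split.
  by move=> i j /negPf neq; rewrite ffunE /= neq.
set b := finfun _; have -> : \det (Edmonds_val c b t) != 0 =
    (\det (transfer *m (B_val b t)^T) != 0) by rewrite det_Edmonds_val_eq0.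
have -> : (B_val b t)^T = into t *m pinvmx (transfer *m into t).
  apply/matrixP => j i; rewrite mul_diag_mx 2![LHS]mxE ffunE /=.
  move: (pinvmx _) => W; rewrite !mxE.
  by case: (_ == t); rewrite ?mul1r ?mul0r.
rewrite mulmxA mulmxVp ?det1 ?oner_eq0 // -kermx_eq0 -submx0.
apply/rV_subP => u /sub_kermxP uT.
have CG : (1%:M - F_val (fun y => iota (c y))) *m
    map_mx iota (invmx (1%:M - F_val c)) = 1%:M.
  have <- : map_mx iota (1%:M - F_val c) = 1%:M - F_val (fun y => iota (c y)).
    rewrite map_mxB map_mx1; congr (_ - _); apply/matrixP => i j; rewrite !mxE.
    by case: ifP => // _; apply: rmorph0.
  by rewrite -(map_mxM iota) mulmxV ?sub1F_unit // map_mx1.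
have := detz t tN; rewrite (det_Edmonds_eq0 _ _ CG).
set A' := A_val _; set B' := B_val _ _.
(* The generic sink matrix is supported on the edges entering t, so the projection [into t] can be
   inserted for free. *)
have BE : B'^T = map_mx iota (into t) *m B'^T.
  rewrite map_diag_mx; apply/matrixP => j i; rewrite mul_diag_mx !mxE.
  by case: (_ == t); rewrite ?rmorph1 ?rmorph0 ?mul1r ?mul0r.
have -> : A' = map_mx iota (A_val c).
  apply/matrixP => i j; rewrite !mxE.
  by case: ifP => // _; rewrite (rmorph0 iota).
rewrite BE !mulmxA -!map_mxM => /negP detT.
have [->|u0] := eqVneq u 0; first by rewrite sub0mx.
(* A nonzero kernel vector over F would stay nonzero over [R] and kill the generic transfer
   matrix. *)
case: detT; apply/det0P; exists (map_mx iota u).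
  apply: contraNneq u0 => /rowP u0; apply/eqP/rowP => i.
  by have := u0 i; rewrite !mxE => /eqP; rewrite fmorph_eq0 => /eqP.
by rewrite mulmxA -map_mxM uT map_mx0 mul0mx.
Qed.

End Field.

(** * Degree in one variable *)

Section VariableDegree.

Variables (n : nat) (v : 'I_n).

Definition degree_le (S : nzRingType) (d : nat) (p : {mpoly S[n]}) : bool :=
  all (fun M : 'X_{1..n} => M v <= d)%N (msupp p).

Lemma degree_leP (S : nzRingType) (d : nat) (p : {mpoly S[n]}) :
  reflect (forall M, M \in msupp p -> (M v <= d)%N) (degree_le d p).
Proof. exact: allP. Qed.

Lemma degree_leW (S : nzRingType) (d e : nat) (p : {mpoly S[n]}) :
  (d <= e)%N -> degree_le d p -> degree_le e p.
Proof.
by move=> le_de /degree_leP pd; apply/degree_leP => M /pd /leq_trans; apply.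
Qed.

Lemma degree_leC (S : nzRingType) (d : nat) (a : S) : degree_le d a%:MP_[n].
Proof.
apply/degree_leP => M; rewrite msuppC; case: ifP => // _.
by rewrite inE => /eqP->; rewrite mnmE.
Qed.

Lemma degree_leX (S : nzRingType) (w : 'I_n) :
  degree_le (w == v) ('X_w : {mpoly S[n]}).
Proof.
by apply/degree_leP => M; rewrite msuppX inE => /eqP->; rewrite mnm1E.
Qed.

Lemma degree_leN (S : nzRingType) (d : nat) (p : {mpoly S[n]}) :
  degree_le d (- p) = degree_le d p.
Proof. by apply: perm_all; apply: msuppN. Qed.

Lemma degree_leD (S : nzRingType) (d : nat) (p r : {mpoly S[n]}) :
  degree_le d p -> degree_le d r -> degree_le d (p + r).
Proof.
move=> pd rd; apply/degree_leP => M /msuppD_le.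
by rewrite mem_cat => /orP[]; apply/degree_leP.
Qed.

Lemma degree_leM (S : nzRingType) (d e : nat) (p r : {mpoly S[n]}) :
  degree_le d p -> degree_le e r -> degree_le (d + e) (p * r).
Proof.
move=> /degree_leP pd /degree_leP re; apply/degree_leP => M.
move=> /msuppM_le/allpairsP[[L1 L2] /= [L1p L2r ->]].
by rewrite mnmDE leq_add ?pd ?re.
Qed.

Lemma degree_le_sum (S : nzRingType) (I : Type) (r : seq I) (d : nat)
    (P : pred I) (p : I -> {mpoly S[n]}) :
  (forall i, P i -> degree_le d (p i)) -> degree_le d (\sum_(i <- r | P i) p i).
Proof.
by move=> pd; elim/big_ind: _ => //; [apply: degree_leC | apply: degree_leD].
Qed.

Lemma degree_le_prod (S : nzRingType) (I : Type) (r : seq I) (P : pred I)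
    (d : I -> nat) (p : I -> {mpoly S[n]}) :
  (forall i, P i -> degree_le (d i) (p i)) ->
  degree_le (\sum_(i <- r | P i) d i) (\prod_(i <- r | P i) p i).
Proof.
move=> pd; elim/big_ind2: _ => //; first exact: degree_leC.
by move=> *; apply: degree_leM.
Qed.

(** Each term of the Leibniz formula takes exactly one entry from row [i0], the only row where the
    variable occurs. *)
Lemma degree_le_det (S : comNzRingType) (k : nat) (M : 'M[{mpoly S[n]}]_k)
    (i0 : 'I_k) :
  (forall i j, degree_le (i == i0) (M i j)) -> degree_le 1 (\det M).
Proof.
move=> Md; apply: degree_le_sum => s _; rewrite -[1%N]add0n; apply: degree_leM.
  by rewrite -mpolyC1 -mpolyCN -rmorphXn; apply: degree_leC.
have <- : (\sum_i (i == i0))%N = 1%N.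
  by rewrite (bigD1 i0) //= eqxx big1 ?addn0 // => i /negPf->.
by apply: degree_le_prod.
Qed.

Lemma degree_le_det_Edmonds_val (S : comNzRingType) (y0 : code_var h m)
    (c : code_var h m -> {mpoly S[n]}) (b : sink_var V h m -> {mpoly S[n]})
    (t : V) :
  (forall y, degree_le (y == y0) (c y)) -> (forall z, degree_le 0 (b z)) ->
  degree_le 1 (\det (Edmonds_val c b t)).
Proof.
move=> cd bd.
(* The only row containing the variable: row i of the upper block for a_{i,j}, row i of the lower
   block for f_{i,j}. *)
pose i0 := match y0 with inl ij => lshift m ij.1 | inr ij => rshift h ij.1 end.
apply: (@degree_le_det _ _ _ i0) => i j; rewrite castmxE cast_ord_id /=.
rewrite -[i]splitK -[cast_ord _ j]splitK.
case: (split i) => i'; case: (split _) => j' /=.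
- rewrite block_mxEul mxE; case: ifP => _; last exact: degree_leC.
  by apply: degree_leW (cd _); rewrite /i0; case: eqP => [<-|//]; rewrite eqxx.
- by rewrite block_mxEur mxE; apply: degree_leC.
- rewrite block_mxEdl !mxE; apply: degree_leD.
    by rewrite -mpolyC1 -rmorphMn; apply: degree_leC.
  rewrite degree_leN; case: ifP => _; last exact: degree_leC.
  by apply: degree_leW (cd _); rewrite /i0; case: eqP => [<-|//]; rewrite eqxx.
rewrite block_mxEdr !mxE; case: ifP => _; last exact: degree_leC.
exact: degree_leW (bd _).
Qed.

End VariableDegree.

End NetworkMatrices.

(** * Random coding *)

(* Otherwise the powers of M would form an infinite descending chain. *)
Lemma monomial_order_0 (n : nat) (lt : rel 'X_{1..n}) (M : 'X_{1..n}) :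
  monomial_order lt -> M != 0%MM -> lt 0%MM M.
Proof.
case=> irr trans total add wf M0; have /orP[ltM0|//] := total _ _ M0.
have [|L [k ->] Lmin] := wf (fun L => exists k, L = (M *+ k)%MM).
  by exists 0%MM, 0%N; rewrite mulm0n.
have ltk : lt (M *+ k.+1)%MM (M *+ k)%MM.
  by rewrite mulmS -[X in lt _ X]add0m; apply: add.
have neqk : (M *+ k.+1)%MM != (M *+ k)%MM.
  by apply: contraTneq ltk => ->; rewrite irr.
have := trans _ _ _ ltk (Lmin _ (ex_intro _ k.+1 erefl) neqk).
by rewrite irr.
Qed.

Lemma msupp_reduce (R : nzRingType) (n q : nat) (p : {mpoly R[n]})
    (M : 'X_{1..n}) :
  (1 < q)%N -> M \in msupp (reduce q p) -> forall v, (M v < q)%N.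
Proof.
move=> q1 /msupp_sum_le/flattenP[_ /mapP[L _ ->] /msuppZ_le].
by rewrite msuppX inE => /eqP-> v; rewrite mnmE reduce_exp_lt.
Qed.

Lemma reduce_id (R : nzRingType) (n q : nat) (p : {mpoly R[n]}) :
  (forall M, M \in msupp p -> forall v, (M v < q)%N) -> reduce q p = p.
Proof.
move=> ltp; rewrite [RHS]mpolyE; apply: eq_big_seq => M /ltp ltM.
by congr (_ *: 'X_[_]); apply/mnmP => v; rewrite mnmE reduce_exp_small.
Qed.

Section RandomCoding.

Variables (F : finFieldType) (V : finType) (h m : nat) (N : network V h m).
Variables (K : {set 'I_h * 'I_m}) (J : {set 'I_m * 'I_m}).
Variable c0 : code_var h m -> F.

Local Notation sinkR := (sink_poly h m F V).
Local Notation q := #|F|.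
Local Notation n := (mu K J).

Lemma PtildeE : Ptilde K J N c0 = \prod_(t in sinks N)
  \det (Edmonds_val N
    (plug_in (fun v : 'I_n => 'X_v) (fun y => (((c0 y)%:MP : sinkR)%:MP)))
    (fun z => (mvar F z : sinkR)%:MP) t).
Proof.
rewrite /Ptilde; set g := (X in mmap _ X _).
pose phi : {rmorphism net_poly F V h m -> {mpoly sinkR[n]}} :=
  mmap (@mpolyC n sinkR \o @mpolyC #|sink_var V h m| F) g.
rewrite -[LHS]/(phi (netP F N)) netPE rmorph_prod; apply: eq_bigr => t _.
rewrite (rmorph_det_Edmonds_val _ phi); congr (\det _).
by apply: eq_Edmonds_val => y; rewrite /phi /mvar /= mmapX mmap1U /g enum_rankK.
Qed.

Lemma meval_Ptilde (x : {ffun 'I_n -> F}) :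
  (Ptilde K J N c0).@[iota_point (@mpolyC _ F) x] = \prod_(t in sinks N)
    \det (Edmonds_val N (fun y => (plug_in x c0 y)%:MP : sinkR)
                        (fun z => mvar F z) t).
Proof.
rewrite PtildeE rmorph_prod; apply: eq_bigr => t _.
rewrite (rmorph_det_Edmonds_val _ (meval _)); congr (\det _).
apply: eq_Edmonds_val => y /=; last by rewrite mevalC.
by rewrite /plug_in; case: pickP => [v _|_]; rewrite ?mevalXU ?mevalC.
Qed.

(** Each sink contributes a factor of degree at most 1 in every X_v, so all exponents are at most
    |T| and reduction changes nothing. *)
Lemma reduce_Ptilde : (#|sinks N| < q)%N -> Phat K J N c0 = Ptilde K J N c0.
Proof.
move=> ltTq; apply: reduce_id => M Mp v; apply: leq_ltn_trans ltTq.
have : degree_le v (\sum_(t in sinks N) 1) (Ptilde K J N c0).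
  rewrite PtildeE; apply: degree_le_prod => t _.
  apply: (@degree_le_det_Edmonds_val _ _ _ _ _ _ _ (enum_val v)) => [y|z];
    last exact: degree_leC.
  rewrite /plug_in; case: pickP => [w /eqP <-|_]; last exact: degree_leC.
  by rewrite (inj_eq enum_val_inj); apply: degree_leX.
by rewrite sum1_card => /degree_leP; apply.
Qed.

Hypothesis K0 : forall i j, etail N j != origin N i -> (i, j) \in K.
Hypothesis J0 : forall i j, ehead N i != etail N j -> (i, j) \in J.
Variables (c : code_var h m -> F) (b : sink_var V h m -> F).
Hypothesis sol : is_solution N c b.
Hypothesis cK : forall i j, (i, j) \in K -> c (avar i j) = c0 (avar i j).
Hypothesis cJ : forall i j, (i, j) \in J -> c (fvar i j) = c0 (fvar i j).

Lemma plug_in_fixed (S : Type) (x : 'I_n -> S) (d : code_var h m -> S) y :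
  y \notin flexible K J -> plug_in x d y = d y.
Proof.
by rewrite /plug_in; case: pickP => // v /eqP <-; rewrite enum_valP.
Qed.

Lemma c0_supported :
  (forall i j, etail N j != origin N i -> c0 (avar i j) = 0) /\
  (forall i j, ehead N i != etail N j -> c0 (fvar i j) = 0).
Proof.
have /andP[/and3P[/forallP ca /forallP cf _] _] := sol.
split=> i j neq.
  rewrite -cK ?K0 //; apply/eqP.
  by have /forallP/(_ j)/implyP := ca i; apply.
rewrite -cJ ?J0 //; apply/eqP.
by have /forallP/(_ j)/implyP := cf i; apply.
Qed.

Lemma success_of_meval (x : {ffun 'I_n -> F}) :
  (Ptilde K J N c0).@[iota_point (@mpolyC _ F) x] != 0 ->
  success N c0 x.
Proof.
have [c0a c0f] := c0_supported.
rewrite meval_Ptilde => /prodf_neq0.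
move=> /(@exists_sink_values _ _ _ _ _ (plug_in x c0) _ (@mpolyC _ F)).
have ca i j : etail N j != origin N i -> plug_in x c0 (avar i j) = 0.
  by move=> neq; rewrite plug_in_fixed ?c0a // inE negbK K0.
have cf i j : ehead N i != etail N j -> plug_in x c0 (fvar i j) = 0.
  by move=> neq; rewrite plug_in_fixed ?c0f // inE negbK J0.
case=> b' b'E; apply/existsP; exists b'; apply/andP; split.
  apply/and3P; split.
  - by do 2!apply/forallP => ?; apply/implyP => /ca->.
  - by do 2!apply/forallP => ?; apply/implyP => /cf->.
  apply/forallP => t; apply/implyP => /b'E[b'0 _].
  by do 2!apply/forallP => ?; apply/implyP => /b'0->.
apply/forallP => t; apply/implyP => /b'E[_ det0].
by rewrite can_recoverE.
Qed.

Lemma Phat_neq0 : Phat K J N c0 != 0.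
Proof.
pose x : {ffun 'I_n -> F} := [ffun v => c (enum_val v)].
apply: contraNneq (oner_neq0 F) => Phat0.
have : (Ptilde K J N c0).@[iota_point (@mpolyC _ F) x] = 0.
  by rewrite -meval_reduce -/(Phat K J N c0) Phat0 meval0.
(* [x] lists the flexible coefficients of the given solution; substituting its sink values [b] as
   well gives P at that solution, where no factor vanishes. *)
move/(congr1 (meval (fun k => b (enum_val k)))).
rewrite meval_Ptilde meval0 rmorph_prod => /eqP/prodf_eq0[t tN].
rewrite (rmorph_det_Edmonds_val _ (meval _)).
have /andP[/and3P[/forallP ca _ _] /forallP/(_ t)/implyP/(_ tN)] := sol.
rewrite can_recoverE => [det0|i j neq]; last first.
  by apply/eqP; have /forallP/(_ j)/implyP := ca i; apply.
rewrite (@eq_Edmonds_val _ _ _ _ _ _ c _ b) ?(negPf det0) // => y; last first.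
  by rewrite /mvar /= mevalXU enum_rankK.
rewrite /= mevalC; have [yflex|yfix] := boolP (y \in flexible K J).
  rewrite /plug_in; case: pickP => [v /eqP <-|none]; first by rewrite ffunE.
  by have := none (enum_rank_in yflex y); rewrite enum_rankK_in ?eqxx.
rewrite plug_in_fixed //; move: yfix.
by case: y => [[i j]|[i j]]; rewrite inE negbK => ?; rewrite -(cK, cJ).
Qed.

(** The probability is the number of successful points divided by q^mu. The order enters through
    these properties alone, so that the statement also applies to the order [<] on multinomials. *)
Lemma footprint_success (lt : rel 'X_{1..n}) (M : 'X_{1..n}) :
  irreflexive lt -> transitive lt ->
  (forall L M, L != M -> lt L M || lt M L) ->
  (forall L M N, lt L M -> lt (L + N)%MM (M + N)%MM) ->
  (forall M, M != 0%MM -> lt 0%MM M) ->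
  leading_monomial lt (Phat K J N c0) M ->
  q%:R ^- n * \prod_(v < n) (q%:R - (M v)%:R) <= success_probability K J N c0.
Proof.
move=> irr trans total add lt0 leadM.
have ltM := msupp_reduce (finNzRing_gt1 F) (proj1 leadM).
rewrite /success_probability.
rewrite [leRHS](eq_bigr (fun=> q%:R ^- n)) => [|x _]; last first.
  by rewrite prodr_const card_ord exprVn.
rewrite sumr_const -[X in _ <= X]mulr_natr.
rewrite ler_wpM2l ?invr_ge0 ?exprn_ge0 //.
under eq_bigr => v _ do rewrite -natrB ?(ltnW (ltM v)) //.
rewrite -natr_prod ler_nat.
apply: leq_trans
  (footprint_bound (@mpolyC _ F) irr trans total add lt0 leadM ltM) _.
apply/subset_leq_card/subsetP => x; rewrite inE meval_reduce.
exact: success_of_meval.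
Qed.

End RandomCoding.

Theorem theorem5 (F : finFieldType) (V : finType) (h m : nat)
    (N : network V h m)
    (K : {set 'I_h * 'I_m}) (J : {set 'I_m * 'I_m})
    (K0 : forall i j, etail N j != origin N i -> (i, j) \in K)
    (J0 : forall i j, ehead N i != etail N j -> (i, j) \in J)
    (c0 : code_var h m -> F)
    (solvable : exists (c : code_var h m -> F) (b : sink_var V h m -> F),
       [/\ is_solution N c b,
           forall i j, (i, j) \in K -> c (avar i j) = c0 (avar i j)
         & forall i j, (i, j) \in J -> c (fvar i j) = c0 (fvar i j)]) :
  [/\ (#|sinks N| < #|F|)%N -> Phat K J N c0 = Ptilde K J N c0,
      forall lt : rel 'X_{1..mu K J}, monomial_order lt ->
        (exists j, leading_monomial lt (Phat K J N c0) j) /\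
        (forall j, leading_monomial lt (Phat K J N c0) j ->
           #|F|%:R ^- mu K J * \prod_(v < mu K J) (#|F|%:R - (j v)%:R)
             <= success_probability K J N c0)
    & #|F|%:R ^- mu K J *
        min_on_support (Phat K J N c0)
          (fun s => \prod_(v < mu K J) (#|F|%:R - (s v)%:R))
        <= success_probability K J N c0].
Proof.
have [c [b [sol cK cJ]]] := solvable.
have Phat0 := Phat_neq0 sol cK cJ.
split=> [|lt ordlt|]; first exact: reduce_Ptilde.
  have lt0 L := monomial_order_0 (M := L) ordlt.
  case: ordlt => irr trans total add _; split.
    exact: leading_monomial_exists.
  by move=> j; apply: (footprint_success K0 J0 sol cK cJ).
(* For the bound by the minimum any one suitable order will do: its leading monomial lies in the
   support, so the minimum is at most the value there. *)
have irr : irreflexive (fun L M : 'X_{1..mu K J} => L < M)%O.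
  by move=> L; apply: ltxx.
have trans : transitive (fun L M : 'X_{1..mu K J} => L < M)%O.
  by move=> L M L'; apply: lt_trans.
have total (L M : 'X_{1..mu K J}) : L != M -> (L < M)%O || (M < L)%O.
  by rewrite neq_lt.
have [j leadj] := leading_monomial_exists trans total Phat0.
apply: le_trans (footprint_success K0 J0 sol cK cJ irr trans total _ _ leadj).
- rewrite ler_wpM2l ?invr_ge0 ?exprn_ge0 //.
  exact: ge_bigmin_seq (proj1 leadj) _.
- by move=> L M L'; rewrite ltmc_add2l.
by move=> L L0; rewrite lt_neqAle eq_sym L0 le0x.
Qed.
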